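(* Let $E$ be a real uniformly convex and smooth Banach space satisfying Opial's condition and let $K$ be a nonempty closed convex subset of $E$ with a sunny nonexpansive retraction $P:E\to K$. Let $T_1,T_2:K\to E$ be two weakly inward, nonself uniformly $L$-Lipschitzian, total asymptotically nonexpansive mappings with sequences $\{\mu_n\},\{\lambda_n\}$ and function $\phi$, such that $\sum_{n=1}^\infty \mu_n<\infty$ and $\sum_{n=1}^\infty\lambda_n<\infty$, and suppose $F=F(T_1)\cap F(T_2)\neq\emptyset$. Suppose that there exist $M,M^*>0$ such that $\phi(\kappa)\le M^*\kappa$ for all $\kappa\ge M$. Let $\{\alpha_n\}$ and $\{\beta_n\}$ be two real sequences in $[\varepsilon,1-\varepsilon]$ for some $\varepsilon\in(0,1)$. Suppose that $\{x_n\}$ is generated by $x_1\in K$ and, for $n\in\mathbb{N}$, $$x_{n+1}=(1-\alpha_n)(PT_1)^n y_n+\alpha_n (PT_2)^n y_n,\qquad y_n=(1-\beta_n)x_n+\beta_n(PT_1)^n x_n .$$ If $I-T_1$ and $I-T_2$ are demiclosed at zero, then $\{x_n\}$ converges weakly to a common fixed point of $T_1$ and $T_2$.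
   Context: A nonexpansive retraction $P:E\to K$ of $E$ onto $K$ is a nonexpansive map ($\|Px-Py\|\le\|x-y\|$) with $Px=x$ for all $x\in K$; it is sunny if $P(Px+t(x-Px))=Px$ for all $x\in E$ and all $t\ge0$. For $T:K\to E$, $PT:K\to K$ is the composition $x\mapsto P(Tx)$ and $(PT)^n$ is its $n$-th iterate ($(PT)^0$ is the identity). Fixed point sets: $F(T)=\{x\in K: Tx=x\}$. $I$ is the identity. $E$ is smooth if $\lim_{t\to0}\frac{\|x+ty\|-\|x\|}{t}$ exists for all $x,y$ with $\|x\|=\|y\|=1$. $E$ satisfies Opial's condition if, whenever a sequence $\{z_n\}$ in $E$ converges weakly to $z_0\in E$ and $z\in E$, $z\neq z_0$, one has $\limsup_{n\to\infty}\|z_n-z_0\|<\limsup_{n\to\infty}\|z_n-z\|$. A nonself mapping $T:K\to E$ is called total asymptotically nonexpansive (with sequences $\{\mu_n\},\{\lambda_n\}$ and function $\phi$) if $\{\mu_n\},\{\lambda_n\}$ are nonnegative real sequences with $\mu_n,\lambda_n\to0$ as $n\to\infty$, $\phi:\mathbb{R}\to\mathbb{R}$ is a strictly increasing continuous function with $\phi(0)=0$, and $$\|(PT)^n x-(PT)^n y\|\le \|x-y\|+\mu_n\phi(\|x-y\|)+\lambda_n\quad\text{for all }x,y\in K,\ n\ge1.$$ When two mappings $T_1,T_2$ are considered, both satisfy this inequality with the same $\{\mu_n\},\{\lambda_n\},\phi$. $T:K\to E$ is uniformly $L$-Lipschitzian if there is a constant $L>0$ such that $\|T(PT)^{n-1}x-T(PT)^{n-1}y\|\le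 L\|x-y\|$ for all $x,y\in K$, $n\ge1$. $T:K\to E$ is weakly inward if for every $x\in K$, $Tx$ belongs to the closure of $I_K(x)=\{x+\lambda(u-x):u\in K,\ \lambda\ge1\}$. A mapping $S$ with domain $K$ and values in $E$ is demiclosed at $p$ if for every sequence $\{z_n\}$ in $K$, $z_n\rightharpoonup z_0$ (weakly) and $Sz_n\to p$ (in norm) imply $Sz_0=p$. *)

(* Defs.v *)
From HB Require Import structures.
From mathcomp Require Import all_boot all_order all_algebra.
From mathcomp Require Import all_classical all_reals all_analysis.
Import Order.TTheory GRing.Theory Num.Theory.
Import numFieldNormedType.Exports.

Set Implicit Arguments.
Unset Strict Implicit.
Unset Printing Implicit Defensive.

Local Open Scope classical_set_scope.
Local Open Scope ring_scope.

Definition uniformly_convex (R : realType) (E : normedModType R) : Prop :=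
  forall eps : R, 0 < eps -> eps <= 2 ->
  exists2 delta : R, 0 < delta &
    forall x y : E, `|x| <= 1 -> `|y| <= 1 -> eps <= `|x - y| ->
      `|2^-1 *: (x + y)| <= 1 - delta.

Definition smooth (R : realType) (E : normedModType R) : Prop :=
  forall x y : E, `|x| = 1 -> `|y| = 1 ->
    cvg ((fun t : R => (`|x + t *: y| - `|x|) / t) @ 0^').

Definition weakly_cvg (R : realType) (E : normedModType R)
    (z : nat -> E) (z0 : E) : Prop :=
  forall f : {linear E -> R^o}, continuous f ->
    f (z n) @[n --> \oo] --> f z0.

(* The limsups are taken in the extended reals, where they always exist. *)
Definition opial (R : realType) (E : normedModType R) : Prop :=
  forall (z : nat -> E) (z0 : E), weakly_cvg z z0 ->
  forall w : E, w <> z0 ->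
    (limn_esup (fun n => `|z n - z0|%:E) <
     limn_esup (fun n => `|z n - w|%:E))%E.

Definition sunny_nonexpansive_retraction (R : realType) (E : normedModType R)
    (K : set E) (P : E -> E) : Prop :=
  [/\ forall x, K (P x),
      forall x, K x -> P x = x,
      forall x y, `|P x - P y| <= `|x - y|
    & forall (x : E) (t : R), 0 <= t -> P (P x + t *: (x - P x)) = P x].

(* In what follows a nonself mapping from K to E is a total function
   T : E -> E of which only the restriction to K is ever constrained or
   evaluated; since P takes its values in K, the iterates of P \o T at points
   of K also depend on that restriction only. *)

Definition fixed_points (E : Type) (K : set E) (T : E -> E) : set E :=
  [set x | K x /\ T x = x].

(* The sequences are indexed from 1; mu 0 and lambda 0 are irrelevant. *)
Definition total_asymptotically_nonexpansive (R : realType)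
    (E : normedModType R) (K : set E) (P : E -> E)
    (mu lambda : nat -> R) (phi : R -> R) (T : E -> E) : Prop :=
  [/\ (forall n, (1 <= n)%N -> 0 <= mu n /\ 0 <= lambda n),
      mu n @[n --> \oo] --> (0 : R) /\ lambda n @[n --> \oo] --> (0 : R),
      [/\ {homo phi : s t / s < t}, continuous phi & phi 0 = 0]
    & forall x y n, K x -> K y -> (1 <= n)%N ->
        `|iter n (P \o T) x - iter n (P \o T) y|
          <= `|x - y| + mu n * phi `|x - y| + lambda n].

Definition uniformly_lipschitzian (R : realType) (E : normedModType R)
    (K : set E) (P : E -> E) (L : R) (T : E -> E) : Prop :=
  0 < L /\
  forall x y n, K x -> K y -> (1 <= n)%N ->
    `|T (iter n.-1 (P \o T) x) - T (iter n.-1 (P \o T) y)| <= L * `|x - y|.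

Definition inward_set (R : realType) (E : normedModType R) (K : set E)
    (x : E) : set E :=
  [set z | exists (u : E) (l : R), [/\ K u, 1 <= l & z = x + l *: (u - x)]].

Definition weakly_inward (R : realType) (E : normedModType R) (K : set E)
    (T : E -> E) : Prop :=
  forall x, K x -> closure (inward_set K x) (T x).

(* The weak limit is required to lie in the domain K of S; this is automatic
   when K is closed and convex. *)
Definition demiclosed (R : realType) (E : normedModType R) (K : set E)
    (S : E -> E) (p : E) : Prop :=
  forall (z : nat -> E) (z0 : E), (forall n, K (z n)) -> K z0 ->
    weakly_cvg z z0 -> S (z n) @[n --> \oo] --> p -> S z0 = p.

(* Main.v *)
(* Write S_i = P T_i. The distances from x_n to a common fixed point w satisfy
   a_(n+1) <= (1 + b_n) a_n + c_n with summable b and c, hence converge, and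
   uniform convexity, applied to the two convex combinations of the scheme, gives
   |x_n - S_i^n x_n| -> 0 and then |x_n - S_i x_n| -> 0. If a subsequence converges
   weakly to q, then S_i^m q asymptotically minimizes w |-> limsup |x_n - w| as
   m -> oo; Opial's condition and uniform convexity force S_i^m q -> q, so
   S_i q = q, and sunniness with weak inwardness upgrades this to T_i q = q.
   Opial's condition then shows that all weak subsequential limits coincide.

   Weak sequential compactness of bounded sets is obtained without duality theory:
   in a uniformly convex Banach space the closed midpoint convex members of a
   filter containing a bounded set have a common point, so every bounded sequence
   converges weakly along every ultrafilter; smoothness turns the derivative of
   the norm into norming functionals, countably many of which suffice to extract
   a weakly convergent subsequence. *)

Require Import Defs.
From HB Require Import structures.
From mathcomp Require Import all_boot all_order all_algebra.
From mathcomp Require Import all_classical all_reals all_analysis.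
From mathcomp Require Import lra.
Import Order.TTheory GRing.Theory Num.Theory.
Import numFieldNormedType.Exports.

Set Implicit Arguments.
Unset Strict Implicit.
Unset Printing Implicit Defensive.

Local Open Scope classical_set_scope.
Local Open Scope ring_scope.

(** * Uniform convexity *)

(** If [|u - v| >= eta], uniform convexity shortens the midpoint by a factor [1 - d]; a combination
    with [t <= 1/2] puts weight [2t >= 2 eps] on that midpoint and so drops below [r - delta]. One
    [delta] serves all [t]. *)
Lemma uniformly_convex_near_extremal (R : realType) (E : normedModType R)
    (eps eta r : R) :
  uniformly_convex E -> 0 < eps -> 0 < eta -> 0 <= r ->
  exists2 delta : R, 0 < delta & forall (t : R) (u v : E),
    eps <= t <= 1 - eps -> `|u| <= r + delta -> `|v| <= r + delta ->
    r - delta <= `|(1 - t) *: u + t *: v| -> `|u - v| < eta.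
Proof.
move=> UC eps0 eta0 r0.
have r1 : 0 < r + 1 by lra.
(* As [delta <= 1], [eta / (r + 1)] bounds the distance below after rescaling into the unit ball; 2
   caps the range in which the modulus is given. *)
pose e := Num.min (eta / (r + 1)) 2.
have e0 : 0 < e by rewrite lt_min divr_gt0/=.
have e2 : e <= 2 by rewrite ge_min lexx orbT.
have [d d0 dP] := UC e e0 e2.
have edeta0 : 0 < eps * d * eta by rewrite !mulr_gt0.
pose delta := Num.min 1 (eps * d * eta / 4).
have delta0 : 0 < delta by rewrite lt_min ltr01/= divr_gt0.
have delta1 : delta <= 1 by rewrite ge_min lexx.
have delta4 : delta * 4 <= eps * d * eta.
  by rewrite -ler_pdivlMr// ge_min lexx orbT.
have half (t : R) (u v : E) : eps <= t -> t <= 2^-1 ->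
    `|u| <= r + delta -> `|v| <= r + delta ->
    r - delta <= `|(1 - t) *: u + t *: v| -> `|u - v| < eta.
  move=> epst t2 ur vr uvr; rewrite ltNge; apply/negP => etauv.
  have R0 : 0 < r + delta by lra.
  have R0' : r + delta != 0 by rewrite gt_eqF.
  have mid : `|2^-1 *: (u + v)| <= (r + delta) * (1 - d).
    have := dP ((r + delta)^-1 *: u) ((r + delta)^-1 *: v).
    rewrite -scalerBr -scalerDr scalerA mulrC -scalerA !normrZ gtr0_norm ?invr_gt0//.
    rewrite !ler_pdivrMl// !mulr1 => -/(_ ur vr); apply.
    rewrite ler_pdivlMl// (le_trans _ etauv)//.
    rewrite (@le_trans _ _ ((r + 1) * (eta / (r + 1))))//.
      by rewrite ler_pM ?lerD2l ?ge_min ?lexx ?(ltW R0) ?(ltW e0).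
    by rewrite mulrC divfK// gt_eqF.
  have eta2 : eta <= 2 * (r + delta).
    by rewrite (le_trans etauv)// (le_trans (ler_normB _ _))//; lra.
  have : `|(1 - t) *: u + t *: v| <=
      (1 - 2 * t) * (r + delta) + 2 * t * ((r + delta) * (1 - d)).
    have -> : (1 - t) *: u + t *: v =
        (1 - 2 * t) *: u + (2 * t) *: (2^-1 *: (u + v)).
      rewrite scalerA mulrAC divff ?pnatr_eq0// mul1r scalerDr addrA -scalerDl.
      by congr (_ *: _ + _); lra.
    have t0 : 0 <= 2 * t by lra.
    have t1 : 0 <= 1 - 2 * t by lra.
    rewrite (le_trans (ler_normD _ _))// normrZ (ger0_norm t1)
      [X in _ + X]normrZ (ger0_norm t0).
    by rewrite lerD// ler_wpM2l//; lra.
  have : eps * d * eta <= 2 * t * d * (r + delta).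
    rewrite (@le_trans _ _ (eps * d * (2 * (r + delta))))//.
      by rewrite ler_wpM2l// mulr_ge0// ltW.
    have : eps * (d * (r + delta)) <= t * (d * (r + delta)).
      by rewrite ler_wpM2r// mulr_ge0// ltW.
    by lra.
  by lra.
exists delta => // t u v /andP[epst t1] ur vr uvr.
have [t2|t2] := leP t 2^-1; first exact: half uvr.
rewrite distrC; apply: (half (1 - t)) => //; [by lra|by lra|].
by rewrite subKr [X in `|X|]addrC.
Qed.

(** Uniform convexity only speaks of midpoints, and this weak convexity is easy to check for the
    closure of a rational span. *)
Definition midpoint_convex (R : realType) (E : normedModType R) (C : set E) :=
  forall a b, C a -> C b -> C (2^-1 *: (a + b)).

Lemma midpoint_half (R : realType) (E : normedModType R) (a b : E) :
  2^-1 *: (a + b) = (1 - 2^-1) *: a + 2^-1 *: b.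
Proof. by rewrite scalerDr; congr (_ *: _ + _); lra. Qed.

(* The points of almost minimal norm of the members of the filter form a Cauchy
   filter, whose limit lies in all closed midpoint convex members. *)
Lemma uniformly_convex_filter_point (R : realType) (E : completeNormedModType R)
    (F : set_system E) (B : R) :
  uniformly_convex E -> ProperFilter F -> F [set v | `|v| <= B] ->
  exists w, forall C, closed C -> midpoint_convex C -> F C -> C w.
Proof.
move=> UC FF FB.
pose good (C : set E) := [/\ closed C, midpoint_convex C & F C].
have goodI C D : good C -> good D -> good (C `&` D).
  move=> [cC mC FC] [cD mD FD]; split; [exact: closedI| |exact: filterI].
  by move=> a b [Ca Da] [Cb Db]; split; [exact: mC|exact: mD].
have goodT : good setT.
  by split; [exact: closedT| |exact: filterT].
(* [sup S] is the supremum of the distances from 0 to the good sets. *)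
pose S := [set s : R | exists2 C, good C & forall c, C c -> s <= `|c|].
have S0 : S 0 by exists setT.
have ubS : ubound S B.
  move=> s [C [_ _ FC] sC].
  have [v [Cv vB]] := filter_ex (filterI FC FB).
  exact: le_trans (sC v Cv) vB.
have supS : has_sup S by split; [exists 0|exists B].
have s0 : 0 <= sup S by apply: sup_upper_bound.
have lower (e : R) : 0 < e -> exists2 C, good C & forall c, C c -> sup S - e <= `|c|.
  move=> e0; have [s [C gC sC] es] := sup_adherent e0 supS.
  by exists C => // c /sC; apply/le_trans/ltW.
have upper C (e : R) : good C -> 0 < e -> exists2 c, C c & `|c| < sup S + e.
  move=> gC e0; apply: contrapT => nC.
  have : S (sup S + e).
    exists C => // c Cc; rewrite leNgt; apply/negP => ce.
    by apply: nC; exists c.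
  by move=> /(sup_upper_bound supS); rewrite gerDl leNgt e0.
pose D := [set Ce : set E * R | good Ce.1 /\ 0 < Ce.2].
pose G := filter_from D (fun Ce => Ce.1 `&` [set c | `|c| < sup S + Ce.2]).
have GF : ProperFilter G.
  apply: filter_from_proper; last first.
    by move=> [C e] [/= gC e0]; have [c] := upper C e gC e0; exists c.
  apply: filter_from_filter; first by exists (setT, 1); split.
  move=> [C e] [C' e'] [/= gC e0] [/= gC' e'0].
  exists (C `&` C', Num.min e e').
    by split => /=; [exact: goodI|rewrite lt_min e0].
  by move=> c [/= [Cc C'c]]; rewrite addr_minr lt_min => /andP[].
(* Two points of [C] of norm below [sup S + d] have their midpoint in [C], hence of norm at least
   [sup S - d], so they are close. *)
have Gcauchy : cauchy_ex G.
  move=> e e0; have half0 : (0 : R) < 2^-1 by rewrite invr_gt0.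
  have [d d0 dP] := uniformly_convex_near_extremal UC half0 e0 s0.
  have [C gC Cd] := lower d d0.
  have [x Cx xd] := upper C d gC d0.
  exists x, (C, d); first by split.
  move=> c [/= Cc cd]; rewrite -ball_normE /=.
  apply: (dP 2^-1) => //; [lra|exact: ltW|exact: ltW|].
  by rewrite -midpoint_half; apply: Cd; case: gC => _ mC _; exact: mC.
have Gw : cvg G by apply: cauchy_cvg; exact: cauchy_exP.
exists (lim G) => C cC mC FC; apply: (cC) => N Nw.
apply: (@filter_ex _ G); apply: filterI; last exact: Gw.
by exists (C, 1) => [|c []].
Qed.

(** * Weak sequential compactness *)

(** Half-spaces are closed and midpoint convex, so [w] lies in each one that contains [z n] along
    the ultrafilter. Were [f (z n)] not close to [f w], the ultrafilter would select [f >= f w + e]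
    or [f <= f w - e], and neither contains [w]. *)
Lemma ultrafilter_weak_limit (R : realType) (E : completeNormedModType R)
    (T : Type) (U : set_system T) (z : T -> E) (B : R) :
  uniformly_convex E -> UltraFilter U -> (forall n, `|z n| <= B) ->
  exists w, (forall f : {linear E -> R^o}, continuous f ->
               f (z n) @[n --> U] --> f w) /\
    (forall C, closed C -> midpoint_convex C -> (forall n, C (z n)) -> C w).
Proof.
move=> UC UU zB.
have zU : ProperFilter (z @ U) by apply: fmap_proper_filter; exact: ultra_proper.
have zUB : (z @ U) [set v | `|v| <= B] by apply: (@filterE _ U).
have [w wP] := uniformly_convex_filter_point UC zU zUB.
exists w; split; last first.
  by move=> C cC mC Cz; apply: wP => //; exact: (@filterE _ U).
move=> f cf.
have clF (s a : R) : closed [set v | a <= s * f v].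
  apply: (@closed_comp _ _ (fun v => s * (f v : R)) [set t | a <= t]).
    by move=> v _; apply: cvgM; [exact: cvg_cst|exact: cf].
  exact: closed_ge.
have halfspace (s e : R) : 0 < e -> ~ U [set n | s * f w + e <= s * f (z n)].
  move=> e0 Ue; have : s * f w + e <= s * f w.
    apply: (wP [set v | s * f w + e <= s * f v]) => // a b /= ha hb.
    rewrite linearZ linearD /=.
    rewrite /GRing.scale/=; lra.
  by rewrite gerDl leNgt e0.
apply/cvgrPdist_lt => e e0.
have [//|Ue] := in_ultra_setVsetC [set n | `|f w - f (z n)| < e] UU.
have [U1|U1] := in_ultra_setVsetC [set n | 1 * f w + e <= 1 * f (z n)] UU.
  by case: (halfspace 1 e e0).
case: (halfspace (-1) e e0); apply: filterS (filterI Ue U1) => n /= [].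
move=> /negP + /negP; rewrite -leNgt -ltNge ler_normr => /orP[]; lra.
Qed.

(** The functional is the derivative of the norm at [d / |d|], which smoothness provides; this takes
    the place of the Hahn-Banach theorem. *)
Lemma smooth_norming_functional (R : realType) (E : normedModType R) (d : E) :
  smooth E -> d != 0 ->
  exists f : {linear E -> R^o},
    [/\ continuous f, f d = `|d| & forall v, `|f v| <= `|v|].
Proof.
move=> sm d0; have nd0 : 0 < `|d| by rewrite normr_gt0.
have [x [x1 dx]] : exists x, `|x| = 1 /\ d = `|d| *: x.
  exists (`|d|^-1 *: d); split; last by rewrite scalerA mulfV ?scale1r ?gt_eqF.
  by rewrite normrZ gtr0_norm ?invr_gt0// mulVf ?gt_eqF.
(* [gd v l] says that [l] is the derivative in direction [v], with the quotient cleared so that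
   [t = 0] and directions of any length are covered. *)
pose gd (v : E) (l : R) := forall e : R, 0 < e ->
  exists2 r : R, 0 < r & forall t : R, `|t| < r ->
    `| `|x + t *: v| - 1 - t * l| <= e * `|t|.
have gd1 v : `|v| = 1 -> exists l, gd v l.
  move=> v1; have /cvg_ex[/= l] := sm x v x1 v1.
  move/cvgrPdist_le => cvl; exists l => e e0.
  have [r /= r0 rP] := cvl e e0; exists r => // t tr.
  have [->|t0] := eqVneq t 0.
    by rewrite scale0r addr0 x1 subrr mul0r subr0 normr0 mulr0.
  have := rP t; rewrite /ball_ /= sub0r normrN => /(_ tr t0).
  rewrite x1 distrC -(ler_pM2r (_ : 0 < `|t|)) ?normr_gt0//.
  by rewrite -normrM mulrBl divfK// [l * t]mulrC.
have gdex v : exists l, gd v l.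
  have [->|v0] := eqVneq v 0.
    exists 0 => e e0; exists 1 => // t _.
    by rewrite scaler0 addr0 x1 subrr mulr0 subr0 normr0 mulr_ge0// ltW.
  have nv0 : 0 < `|v| by rewrite normr_gt0.
  have [|l lP] := gd1 (`|v|^-1 *: v).
    by rewrite normrZ gtr0_norm ?invr_gt0// mulVf ?gt_eqF.
  exists (`|v| * l) => e e0.
  have [|r r0 rP] := lP (e / `|v|); first exact: divr_gt0.
  exists (r / `|v|); first exact: divr_gt0.
  move=> t tr; have := rP (t * `|v|).
  rewrite scalerA mulfK ?gt_eqF// normrM normr_id -ltr_pdivlMr//.
  move=> /(_ tr); rewrite -[t * `|v| * l]mulrA => /le_trans; apply.
  by rewrite [`|t| * _]mulrC mulrA divfK ?gt_eqF.
have [J JP] := choice gdex.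
have Jlin : linear (J : E -> R^o).
  move=> a u v; have [n nP] : exists n, n = J (a *: u + v) by exists (J (a *: u + v)).
  rewrite -nP; apply/eqP; rewrite eq_sym -subr_eq0 -normr_eq0; apply/negPn/negP => neq.
  pose D : R := a * J u + J v; have {}neq : `|D - n| != 0 by [].
  have D0 : 0 < `|D - n| by rewrite lt_neqAle eq_sym neq normr_ge0.
  (* The expansions at steps [t], [2t] and [2ta] contribute a total error [e * s * (2 + |a|)], which
     this [e] makes half of [s * |D - n|]. *)
  pose e := `|D - n| / (2 * (`|a| + 2)).
  have a2 : 0 < 2 * (`|a| + 2) by rewrite mulr_gt0// ltr_wpDl.
  have e0 : 0 < e by exact: divr_gt0.
  have [ru ru0 ruP] := JP u e e0.
  have [rv rv0 rvP] := JP v e e0.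
  have [rw rw0 rwP] := JP (a *: u + v) e e0.
  pose s := Num.min (ru / (2 * (`|a| + 1))) (Num.min (rv / 2) rw) / 2.
  have a1 : 0 < 2 * (`|a| + 1) by rewrite mulr_gt0// ltr_wpDl.
  have s0 : 0 < s by rewrite divr_gt0// !lt_min rw0 !divr_gt0.
  have ss : s < Num.min (ru / (2 * (`|a| + 1))) (Num.min (rv / 2) rw).
    rewrite /s ltr_pdivrMr// ltr_pMr ?ltr1n//.
    by rewrite !lt_min rw0 !divr_gt0.
  (* Convexity bounds the norm at [x + t (a u + v)] by the mean of those at [x + 2ta u] and
     [x + 2t v]; both signs of [t] together turn the inequality of derivatives into an equality. *)
  have key (t : R) : `|t| = s -> t * (n - D) <= e * s * (2 + `|a|) .
    move=> ts.
    move: ss; rewrite !lt_min => /and3P[su sv sw].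
    have := rwP t; rewrite ts -nP => /(_ sw) /ler_normlP[hw1 hw2].
    have := rvP (2 * t); rewrite normrM ts ger0_norm// mulrC -ltr_pdivlMr//.
    move=> /(_ sv) /ler_normlP[hv1 hv2].
    have := ruP (2 * t * a); rewrite !normrM ts ger0_norm//.
    move=> /(_ _) /ler_normlP[|hu1 hu2].
      move: su; rewrite ltr_pdivlMr// => su.
      have : s * 1 <= s by rewrite mulr1.
      lra.
    have : `|x + t *: (a *: u + v)| <=
        2^-1 * `|x + (2 * t * a) *: u| + 2^-1 * `|x + (2 * t) *: v|.
      have -> : x + t *: (a *: u + v) =
          2^-1 *: (x + (2 * t * a) *: u) + 2^-1 *: (x + (2 * t) *: v).
        rewrite !scalerDr !scalerA addrACA -scalerDl.
        have -> : 2^-1 + 2^-1 = 1 :> R by lra.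
        rewrite scale1r; congr (_ + (_ *: _ + _ *: _)).
          by rewrite !mulrA mulVf ?mul1r.
        by rewrite mulrA mulVf ?mul1r.
      by rewrite (le_trans (ler_normD _ _))// !normrZ gtr0_norm// invr_gt0.
    rewrite /D; lra.
  have : s * `|n - D| <= e * s * (2 + `|a|).
    have [h|h] := ger0P (n - D).
      by apply: key; rewrite gtr0_norm.
    by rewrite mulrN -mulNr; apply: key; rewrite normrN gtr0_norm.
  rewrite distrC; have -> : e * s * (2 + `|a|) = s * (e * (2 + `|a|)) by lra.
  rewrite ler_pM2l// leNgt => /negP; apply.
  rewrite /e mulrAC ltr_pdivrMr// ltr_pM2l//.
  by have : 0 <= `|a| by []; lra.
have Jx : J x = 1.
  apply/eqP; rewrite -subr_eq0 -normr_le0; apply/ler_addgt0Pr => e e0.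
  rewrite add0r; have [r r0 rP] := JP x e e0.
  pose t := Num.min r 1 / 2.
  have t0 : 0 < t by rewrite divr_gt0// lt_min r0 ltr01.
  have tr : t < r.
    by rewrite /t ltr_pdivrMr// gt_min ltr_pMr// ltr1n.
  have := rP t; rewrite gtr0_norm// => /(_ tr).
  rewrite -[X in X + t *: x]scale1r -scalerDl normrZ x1 mulr1 gtr0_norm ?addr_gt0//.
  have -> : 1 + t - 1 - t * J x = t * (1 - J x) by lra.
  rewrite normrM gtr0_norm// [e * t]mulrC.
  by rewrite ler_pM2l// distrC.
have Jle v : `|J v| <= `|v|.
  apply/ler_addgt0Pr => e e0; have [r r0 rP] := JP v e e0.
  have t0 : 0 < r / 2 by exact: divr_gt0.
  have tr : `|r / 2| < r by rewrite gtr0_norm// ltr_pdivrMr// ltr_pMr// ltr1n.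
  have := rP _ tr; rewrite (gtr0_norm t0); set t := r / 2 in t0 * => h.
  rewrite -(ler_pM2l t0) mulrDr [t * e]mulrC.
  have : `| `|x + t *: v| - 1| <= t * `|v|.
    rewrite -x1 (le_trans (ler_dist_dist _ _))// addrAC subrr add0r.
    by rewrite normrZ gtr0_norm.
  have -> : t * `|J v| = `|t * J v| by rewrite normrM gtr0_norm.
  move=> h'.
  have := ler_normB (`|x + t *: v| - 1) (`|x + t *: v| - 1 - t * J v).
  rewrite opprB addrC subrK => /le_trans; apply.
  exact: lerD.
pose lJ := GRing.isLinear.Build R E R^o *:%R (J : E -> R^o) Jlin.
pose f : {linear E -> R^o} := HB.pack (J : E -> R^o) lJ.
exists f; split.
- apply: bounded_linear_continuous; apply/bounded_funP => r.
  by exists r => v vr; apply: le_trans (Jle v) vr.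
- by rewrite {1}dx linearZ/= Jx [LHS]mulr1.
- exact: Jle.
Qed.
Lemma closure_distP (R : realType) (E : normedModType R) (A : set E) (x : E) :
  closure A x <-> forall e : R, 0 < e -> exists2 y, A y & `|x - y| < e.
Proof.
split=> [Ax e e0|xP N /nbhs_ballP[e /= e0 eN]].
  have [y [Ay]] := Ax _ (nbhsx_ballx x e e0).
  by rewrite -ball_normE; exists y.
have [y Ay xy] := xP e e0; exists y; split=> //.
by apply: eN; rewrite -ball_normE.
Qed.

(** If a neighborhood [N] of [l] failed, the trace of [F] on the complement of its preimage would be
    proper and extend to an ultrafilter violating the assumption. *)
Lemma cvg_of_ultrafilters (T : Type) (V : topologicalType) (F : set_system T)
    (u : T -> V) (l : V) : Filter F ->
  (forall U, UltraFilter U -> F `<=` U -> u @ U --> l) -> u @ F --> l.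
Proof.
move=> FF uU N Nl; apply: contrapT => nN.
have FN : ProperFilter (within (~` (u @^-1` N)) F).
  apply: Build_ProperFilter_ex => A WA; apply: contrapT => nA.
  apply: nN; change (F (u @^-1` N)); apply: (@filterS _ F _ _ _ _ WA) => t WAt.
  by apply: contrapT => Nt; apply: nA; exists t; exact: WAt.
have [U [UU FU]] := ultraFilterLemma FN.
have /(_ N Nl) UN : u @ U --> l.
  by apply: uU => A FA; apply: FU; apply: (@filterS _ F _ _ _ _ FA) => t.
have UnN : U (~` (u @^-1` N)).
  apply: FU. exact: withinT.
by have [t []] := filter_ex (@filterI _ U _ (u @^-1` N) _ UN UnN).
Qed.

Lemma cvgn_ge_id (s : nat -> nat) : (forall k, (k <= s k)%N) -> s @ \oo --> \oo.
Proof.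
move=> sP A [N _ NA]; exists N => // k /= Nk.
by apply: NA; exact: leq_trans Nk (sP k).
Qed.

(* The rational linear combinations of the terms of the sequence, indexed by the
   countable type of rational polynomials. *)
Section rational_span.
Context {R : realType} {E : normedModType R} (z : nat -> E).

Definition rational_comb (p : {poly rat}) : E :=
  \sum_(i < size p) (ratr p`_i : R) *: z i.

Lemma rational_comb_widen (p : {poly rat}) N : (size p <= N)%N ->
  rational_comb p = \sum_(i < N) (ratr p`_i : R) *: z i.
Proof.
move=> pN; rewrite /rational_comb (big_ord_widen N (fun i => ratr p`_i *: z i))//.
rewrite big_mkcond; apply: eq_bigr => i _; case: ifPn => //.
by rewrite -leqNgt => ip; rewrite nth_default// rmorph0 scale0r.
Qed.

Lemma rational_combP a p q :
  rational_comb (a *: p + q) = (ratr a : R) *: rational_comb p + rational_comb q.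
Proof.
pose N := maxn (size (a *: p + q)) (maxn (size p) (size q)).
rewrite !(@rational_comb_widen _ N) ?leq_max ?leqnn ?orbT//.
rewrite scaler_sumr -big_split/=; apply: eq_bigr => i _.
by rewrite coefD coefZ rmorphD rmorphM scalerDl scalerA.
Qed.

Lemma rational_combB p q :
  rational_comb (p - q) = rational_comb p - rational_comb q.
Proof.
by rewrite addrC -scaleN1r rational_combP rmorphN1 scaleN1r addrC.
Qed.

Lemma rational_comb_seq n : rational_comb 'X^n = z n.
Proof.
rewrite (@rational_comb_widen _ n.+1) ?size_polyXn// big_ord_recr/= coefXn eqxx.
rewrite rmorph1 scale1r big1 ?add0r// => i _.
by rewrite coefXn (ltn_eqF (ltn_ord i)) rmorph0 scale0r.
Qed.

Lemma midpoint_convex_closure_rational_comb :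
  midpoint_convex (closure (range rational_comb)).
Proof.
move=> a b /closure_distP aP /closure_distP bP; apply/closure_distP => e e0.
have [_ [p _ <-] ap] := aP e e0; have [_ [q _ <-] bq] := bP e e0.
exists (2^-1 *: (rational_comb p + rational_comb q)).
  exists (2^-1 *: (p + q)) => //.
  rewrite -[X in rational_comb X]addr0 rational_combP.
  rewrite -[p]scale1r rational_combP rmorph1 !scale1r.
  rewrite /rational_comb size_poly0 big_ord0 addr0 fmorphV/=.
  by rewrite rmorph_nat.
rewrite -scalerBr opprD addrACA normrZ gtr0_norm ?invr_gt0// ltr_pdivrMl//.
by rewrite (le_lt_trans (ler_normD _ _))// mulr2n mulrDl mul1r ltrD.
Qed.

End rational_span.

(** The norming functionals [g p] of the rational combinations are countably many, so a diagonal
    choice makes each converge along [s] to its value at an ultrafilter limit [z0]. They separate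
    the points of the closed rational span, so every ultrafilter limit of [z \o s] is [z0]. The
    condition [k <= s k] stands in for strict monotonicity. *)
Lemma bounded_weakly_cvg_subsequence (R : realType) (E : completeNormedModType R)
    (z : nat -> E) (B : R) :
  uniformly_convex E -> smooth E -> (forall n, `|z n| <= B) ->
  exists s z0, [/\ forall k, (k <= s k)%N, weakly_cvg (z \o s) z0 &
    forall C, closed C -> midpoint_convex C -> (forall n, C (z n)) -> C z0].
Proof.
move=> UC sm zB; pose D := rational_comb z.
have /choice[g gP] : forall p, exists f : {linear E -> R^o},
    [/\ continuous f, f (D p) = `|D p| & forall v, `|f v| <= `|v|].
  move=> p; have [Dp0|Dp0] := eqVneq (D p) 0.
    exists (\0 : {linear E -> R^o}); split.
    - by move=> v; exact: cvg_cst.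
    - by rewrite Dp0 normr0.
    - by move=> v; rewrite normr0.
  exact: smooth_norming_functional.
have zD n : closure (range D) (z n).
  by apply: subset_closure; exists 'X^n => //; exact: rational_comb_seq.
have mD : midpoint_convex (closure (range D)).
  exact: midpoint_convex_closure_rational_comb.
have [U [UU ooU]] := ultraFilterLemma eventually_filter.
have [z0 [z0w z0C]] := ultrafilter_weak_limit UC UU zB.
have z0D : closure (range D) z0 by apply: z0C => //; exact: closed_closure.
have /choice[s sP] : forall k, exists n, (k <= n)%N /\
    forall p, (pickle p <= k)%N -> `|g p z0 - g p (z n)| < k.+1%:R^-1.
  move=> k.
  (* At most one [p] has code [i], so the first [k + 1] codes give finitely many sets of the
     ultrafilter. *)
  have near_g (i : 'I_k.+1) : U [set n | forall p, pickle p = i ->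
      `|g p z0 - g p (z n)| < k.+1%:R^-1].
    have [[p pi]|np] := pselect (exists p : {poly rat}, pickle p = i); last first.
      by apply: filterE => n p pi; exfalso; apply: np; exists p.
    have [gc _ _] := gP p.
    have := z0w (g p) gc => /cvgrPdist_lt /(_ k.+1%:R^-1).
    rewrite invr_gt0 ltr0n => /(_ isT); apply: filterS => n gn q qi.
    by have -> // : q = p; apply: (pcan_inj pickleK); rewrite qi.
  have Uk : U [set n | (k <= n)%N] by apply: ooU; exists k.
  have [n [kn nP]] := filter_ex (filterI Uk (filter_forall _ near_g)).
  exists n; split=> // p pk; exact: (nP (Ordinal (pk : (pickle p < k.+1)%N))).
have gs p : g p (z (s n)) @[n --> \oo] --> g p z0.
  apply/cvgrPdist_lt => e e0.
  near=> k; have [_ /(_ p) gk] := sP k.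
  rewrite (lt_trans (gk _))//; first by near: k; exact: nbhs_infty_ge.
  near: k; exact: near_infty_natSinv_lt (PosNum e0).
exists s, z0; split=> // [k|f fc]; first by have [] := sP k.
apply: cvg_of_ultrafilters => V VU ooV.
have [w [ww wC]] := ultrafilter_weak_limit UC VU (fun n => zB (s n)).
have wD : closure (range D) w by apply: wC => //; exact: closed_closure.
have gw p : g p w = g p z0.
  have [gc _ _] := gP p.
  apply: (@cvg_unique _ _ (g p (z (s n)) @[n --> V])) => //.
  - exact: ww.
  - apply: cvg_trans (gs p); exact: cvg_app.
suff <- : w = z0 by exact: ww.
apply/eqP; rewrite -subr_eq0 -normr_eq0; apply/negPn/negP => wz0.
(* [g (p - q)] norms [D p - D q] and vanishes at [w - z0], which gives [|w - z0| <= 2 (|w - D p| +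
   |z0 - D q|) < 4 e]. *)
pose e := `|w - z0| / 5.
have e0 : 0 < e by rewrite divr_gt0// lt_neqAle eq_sym wz0/=.
have ee : `|w - z0| = 5 * e by rewrite mulrC divfK.
have [_ [p _ <-] wp] := (closure_distP _ _).1 wD e e0.
have [_ [q _ <-] zq] := (closure_distP _ _).1 z0D e e0.
have [_ gD gle] := gP (p - q).
have : `|w - z0| <= `|D (p - q)| + (`|w - D p| + `|z0 - D q|).
  rewrite /D rational_combB -/D.
  have -> : w - z0 = (D p - D q) + ((w - D p) - (z0 - D q)).
    by rewrite opprB addrACA subrKC addKr.
  rewrite (le_trans (ler_normD _ _))// lerD2l; exact: ler_normB.
have : `|D (p - q)| <= `|w - D p| + `|z0 - D q|.
  rewrite -gD.
  have -> : g (p - q) (D (p - q)) = g (p - q) ((z0 - D q) - (w - D p)).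
    rewrite /D rational_combB -/D !linearB/= gw; lra.
  by rewrite (le_trans (ler_norm _))// (le_trans (gle _))// [X in _ <= X]addrC ler_normB.
by lra.
Unshelve. all: by end_near. Qed.

(** * Opial's condition and fixed points *)

(** Real form of Opial's condition: the limsup at [z0] is an infimum of suprema over eventual sets,
    so one such supremum [a] already lies below the limsup at [w], and a real [b] is inserted
    between them. *)
Lemma opial_gap (R : realType) (E : normedModType R) (z : nat -> E) (z0 w : E) :
  opial E -> weakly_cvg z z0 -> w <> z0 ->
  exists a b : R, [/\ a < b, \forall n \near \oo, `|z n - z0| <= a &
    forall N, exists2 n, (N <= n)%N & b <= `|z n - w|].
Proof.
move=> op zz0 wz0; have := op z z0 zz0 w wz0.
set l := limn_esup (fun n => `|z n - w|%:E).
move=> /ereal_inf_lt[_ [V ooV <-]]; set u := ereal_sup _ => ul.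
have uV n : V n -> (`|z n - z0|%:E <= u)%E.
  by move=> Vn; apply: ereal_sup_ubound; exists n.
have u0 : (0 <= u)%E.
  by have [n Vn] := filter_ex ooV; apply: le_trans (uV n Vn); rewrite lee_fin.
have lP (b : R) : (b%:E < l)%E -> forall N, exists2 n, (N <= n)%N & b <= `|z n - w|.
  move=> bl N; apply: contrapT => nN.
  suff : (l <= b%:E)%E by rewrite leNgt bl.
  apply: (@le_trans _ _ (ereal_sup ((fun n => `|z n - w|%:E) @` [set n | (N <= n)%N]))).
    by apply: ereal_inf_lbound; exists [set n | (N <= n)%N] => //; exists N.
  apply: ge_ereal_sup => _ [n /= Nn <-]; rewrite lee_fin leNgt; apply/negP => bn.
  by apply: nN; exists n => //; exact: ltW.
clearbody u l; case: u u0 uV ul => [a| |]//; last first.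
  by move=> _ _; rewrite ltNge leey.
move=> a0 aV al; have [b ab bl] : exists2 b, a < b & (b%:E < l)%E.
  case: l al {lP} => [l| |]//; last by exists (a + 1); rewrite ?ltrDl ?ltry.
  rewrite lte_fin => al; exists ((a + l) / 2); rewrite ?lte_fin; lra.
exists a, b; split=> //; last exact: lP.
by apply: filterS ooV => n /aV; rewrite lee_fin.
Qed.

(** Approximate [T x] by [w = x + l (u - x)]. Nonexpansiveness, comparing [u] with the point of the
    ray at parameter [1/l], bounds [|w - x|] by [|w - T x|], so [T x] is arbitrarily close to
    [x]. *)
Lemma sunny_weakly_inward_fixed_point (R : realType) (E : normedModType R)
    (K : set E) (P T : E -> E) (x : E) :
  sunny_nonexpansive_retraction K P -> weakly_inward K T -> K x ->
  P (T x) = x -> T x = x.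
Proof.
move=> [_ Pid Pne Psunny] TK Kx PTx.
apply/eqP; rewrite -subr_eq0 -normr_le0; apply/ler_addgt0Pr => e e0.
have e2 : 0 < e / 2 by exact: divr_gt0.
have [_ [u [l [Ku l1 ->]]]] := (closure_distP _ _).1 (TK x Kx) (e / 2) e2.
set w := x + l *: (u - x) => Tw.
have l0 : 0 < l by apply: lt_le_trans l1.
(* Sunniness retracts the whole ray from x through T x to x. *)
have xw : `|w - x| <= `|w - T x|.
  have := Psunny (T x) l^-1; rewrite invr_ge0 PTx => /(_ (ltW l0)) Pray.
  have := Pne u (x + l^-1 *: (T x - x)); rewrite Pid// Pray.
  rewrite -(ler_pM2l l0) -[X in X * _ <= _](gtr0_norm l0).
  rewrite -[X in _ <= X * _](gtr0_norm l0) -!normrZ.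
  rewrite /w [x + _ - x]addrAC subrr add0r => /le_trans; apply.
  rewrite opprD addrA scalerBr scalerA divff ?gt_eqF// scale1r opprB.
  by rewrite addrA [X in `|X - _| <= _]addrC.
have := ler_distD w (T x) x; rewrite distrC in xw Tw; rewrite distrC.
by move: Tw xw; rewrite [`|w - T x|]distrC [`|x - w|]distrC; lra.
Qed.
Lemma dist_iter_le (R : realType) (E : normedModType R) (K : set E)
    (S : E -> E) (L : R) (m : nat) :
  0 <= L -> (forall x, K x -> K (S x)) ->
  (forall x y, K x -> K y -> `|S x - S y| <= L * `|x - y|) ->
  exists2 c : R, 0 <= c & forall x, K x -> `|x - iter m S x| <= c * `|x - S x|.
Proof.
move=> L0 SK SL; elim: m => [|m [c c0 cP]].
  by exists 0 => // x _; rewrite subrr normr0 mul0r.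
exists (1 + L * c); first by rewrite addr_ge0// mulr_ge0.
move=> x Kx; have KS : K (iter m S x) by elim: (m) => //= k; exact: SK.
rewrite (le_trans (ler_distD (S x) _ _))// mulrDl mul1r lerD2l/=.
rewrite (le_trans (SL _ _ Kx KS))// -mulrA ler_wpM2l//; exact: cP.
Qed.

(* Demiclosedness of I - S at 0: the iterates of S at the weak limit z0 are
   asymptotic minimizers of w |-> limsup |z n - w|; by Opial's condition and
   uniform convexity they must converge to z0. *)
Lemma opial_weak_limit_fixed_point (R : realType) (E : normedModType R)
    (K : set E) (S : E -> E) (L B : R) (z : nat -> E) (z0 : E) :
  uniformly_convex E -> opial E -> weakly_cvg z z0 ->
  (forall n, K (z n)) -> K z0 -> (forall n, `|z n - z0| <= B) ->
  0 <= L -> (forall x, K x -> K (S x)) ->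
  (forall x y, K x -> K y -> `|S x - S y| <= L * `|x - y|) ->
  (forall e, 0 < e -> \forall m \near \oo, forall n,
     `|iter m S (z n) - iter m S z0| <= `|z n - z0| + e) ->
  z n - S (z n) @[n --> \oo] --> (0 : E) ->
  S z0 = z0.
Proof.
move=> UC op zz0 Kz Kz0 zB L0 SK SL Sasy Szz.
(* [inf A] is the limsup of [|z n - z0|]. *)
pose A := [set a : R | \forall n \near \oo, `|z n - z0| <= a].
have AB : A B by apply: nearW.
have lbA : lbound A 0.
  move=> a Aa; have [n /= na] := filter_ex Aa; exact: le_trans na.
have infA : has_inf A by split; [exists B|exists 0].
set r := inf A; have r0 : 0 <= r by apply: lb_le_inf => //; exists B.
have iterK m : K (iter m S z0) by elim: m => //= m; exact: SK.
have iter_cvg (eta : R) : 0 < eta -> \forall m \near \oo, `|iter m S z0 - z0| < eta.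
  move=> eta0; have half0 : (0 : R) < 2^-1 by rewrite invr_gt0.
  have [d d0 dP] := uniformly_convex_near_extremal UC half0 eta0 r0.
  have d3 : 0 < d / 3 by exact: divr_gt0.
  apply: filterS (Sasy _ d3) => m mP; rewrite ltNge; apply/negP => etam.
  (* Opial's condition at this midpoint keeps [z n] farther than [r] from it infinitely often, while
     both endpoints stay within [r + d]. The slack [d] is split between the infimum, the asymptotic
     bound and the displacement of [z n] under the iterate. *)
  have mid : 2^-1 *: (z0 + iter m S z0) <> z0.
    move=> h; have : iter m S z0 - z0 = 0.
      apply/eqP; rewrite subr_eq0; apply/eqP.
      move: (congr1 (fun v => 2 *: v - z0) h).
      by rewrite scalerA divff// scale1r addrAC subrr add0r scaler_nat mulr2n addrK.
    by move=> e; move: etam; rewrite e normr0 leNgt eta0.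
  have [a [b [ab Aa fb]]] := opial_gap op zz0 mid.
  have ra : r <= a by apply: ge_inf => //; exists 0.
  have [a' Aa' ar] := inf_adherent d3 infA.
  have [c c0 cP] := dist_iter_le m L0 SK SL.
  have c1 : 0 < c + 1 by apply: ltr_wpDl.
  move/cvgrPdist_lt: Szz => /(_ _ (divr_gt0 d3 c1)) Szz.
  have [N _ NP] := filterI Aa' Szz.
  have [n Nn bn] := fb N; have [/= na' nS] := NP n Nn.
  have zS : `|z n - iter m S (z n)| <= d / 3.
    move: nS; rewrite sub0r normrN ltr_pdivlMr// => nS.
    rewrite (le_trans (cP _ (Kz n)))// (le_trans _ (ltW nS))//.
    by rewrite mulrC ler_wpM2l// lerDl.
  have : `|(z n - z0) - (z n - iter m S z0)| < eta.
    apply: (dP 2^-1); [by lra| | |].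
    - by rewrite -/r in ar; lra.
    - rewrite (le_trans (ler_distD (iter m S (z n)) _ _))//.
      by have := mP n; rewrite -/r in ar; lra.
    - rewrite -midpoint_half.
      have -> : z n - z0 + (z n - iter m S z0) = 2 *: z n - (z0 + iter m S z0).
        by rewrite addrACA -opprD scaler_nat mulr2n.
      rewrite scalerBr scalerA mulVf ?pnatr_eq0// scale1r.
      by lra.
  rewrite opprB addrC addrA subrK => h.
  by move: etam; rewrite leNgt h.
apply/eqP; rewrite -subr_eq0 -normr_le0; apply/ler_addgt0Pr => e e0.
(* [|S z0 - z0| <= |S^(N+1) z0 - z0| + L |S^N z0 - z0|], hence the tolerance [e / (L + 1)]. *)
have L1 : 0 < L + 1 by apply: ltr_wpDl.
have [N _ NP] := iter_cvg _ (divr_gt0 e0 L1).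
have h1 := ltW (NP N (leqnn N)); have h2 := ltW (NP N.+1 (leqnSn N)).
rewrite add0r (le_trans (ler_distD (iter N.+1 S z0) _ _))//.
have h3 := SL _ _ Kz0 (iterK N); rewrite [X in _ <= _ * X]distrC in h3.
have : L * `|iter N S z0 - z0| <= L * (e / (L + 1)) by rewrite ler_wpM2l.
have : e = L * (e / (L + 1)) + e / (L + 1).
  by rewrite -[X in _ + X]mul1r -mulrDl mulrC divfK// gt_eqF.
move: h2 h3 => /=; lra.
Qed.

(** * The two-step iteration *)

(** The products of the [1 + b i] are bounded by the exponential of the sums, so [a] is bounded by
    some [A]. Subtracting the convergent [d], which gathers the increments [A b i + c i], leaves a
    nonincreasing sequence bounded below. *)
Lemma perturbed_nonincreasing_is_cvgn (R : realType) (a b c : nat -> R)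
    (Bb Bc : R) :
  (forall n, 0 <= a n) -> (forall n, 0 <= b n) -> (forall n, 0 <= c n) ->
  (forall N, \sum_(i < N) b i <= Bb) -> (forall N, \sum_(i < N) c i <= Bc) ->
  (forall n, a n.+1 <= (1 + b n) * a n + c n) ->
  cvgn a.
Proof.
move=> a0 b0 c0 bB cB arec.
pose p N := expR (\sum_(i < N) b i).
have p1 N : 1 <= p N by rewrite -expR0 ler_expR sumr_ge0.
have pS N : (1 + b N) * p N <= p N.+1.
  rewrite /p big_ord_recr/= expRD mulrC ler_wpM2l ?expR_ge0//; exact: expR_ge1Dx.
have ap N : a N <= p N * (a 0%N + \sum_(i < N) c i).
  elim: N => [|N IH]; first by rewrite /p !big_ord0 expR0 mul1r addr0.
  rewrite (le_trans (arec N))// [X in _ <= _ * (_ + X)]big_ord_recr/= addrA mulrDr.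
  rewrite lerD//; last by rewrite ler_peMl.
  rewrite (le_trans (ler_wpM2l _ IH)) ?addr_ge0//.
  by rewrite mulrA ler_wpM2r// addr_ge0// sumr_ge0.
pose A := expR Bb * (a 0%N + Bc).
have aA N : a N <= A.
  rewrite (le_trans (ap N))// ler_pM ?expR_ge0 ?addr_ge0 ?sumr_ge0//.
    by rewrite ler_expR.
  by rewrite lerD2l.
have A0 : 0 <= A by exact: le_trans (aA 0%N).
pose d N := A * \sum_(i < N) b i + \sum_(i < N) c i.
have dB N : d N <= A * Bb + Bc by rewrite lerD// ler_wpM2l.
have cd : cvgn d.
  apply: nondecreasing_is_cvgn; last by exists (A * Bb + Bc) => _ [N _ <-].
  apply/nondecreasing_seqP => N; rewrite /d !big_ord_recr/=.
  by rewrite lerD ?lerDl// ler_wpM2l// lerDl.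
have cad : cvgn (fun n => a n - d n).
  apply: nonincreasing_is_cvgn.
    apply/nonincreasing_seqP => N; rewrite /d !big_ord_recr/=.
    have := arec N; have : b N * a N <= b N * A by rewrite ler_wpM2l.
    by lra.
  exists (- (A * Bb + Bc)) => _ [N _ <-].
  by have := a0 N; have := dB N; lra.
have -> : a = (fun n => (a n - d n) + d n) by apply/funext => n; rewrite subrK.
exact: is_cvgD.
Qed.

Lemma summable_partial_sums_bounded (R : realType) (u : nat -> R) :
  (forall n, (1 <= n)%N -> 0 <= u n) ->
  (\sum_(1 <= n <oo) (u n)%:E < +oo)%E ->
  exists B, forall N, \sum_(i < N) u i.+1 <= B.
Proof.
move=> u0 uoo; exists (fine (\sum_(1 <= n <oo) (u n)%:E)%E) => N.
have s0 : (0 <= \sum_(1 <= n <oo) (u n)%:E)%E.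
  by apply: nneseries_ge0 => n n1 _; rewrite lee_fin u0.
rewrite -lee_fin fineK ?ge0_fin_numE//.
have := @nneseries_lim_ge R (fun n => (u n)%:E) xpredT 1 N.+1.
rewrite big_add1/= big_mkord sumEFin; apply => n n1 _.
by rewrite lee_fin u0.
Qed.

(** Schu's lemma; the weights [t n] may vary because the [delta] of the near-extremal estimate does
    not depend on them. *)
Lemma uniformly_convex_cvg_dist0 (R : realType) (E : normedModType R)
    (eps r : R) (t : nat -> R) (u v : nat -> E) :
  uniformly_convex E -> 0 < eps -> 0 <= r ->
  (forall n, eps <= t n <= 1 - eps) ->
  (forall e, 0 < e -> \forall n \near \oo, `|u n| <= r + e) ->
  (forall e, 0 < e -> \forall n \near \oo, `|v n| <= r + e) ->
  (forall e, 0 < e -> \forall n \near \oo,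
     r - e <= `|(1 - t n) *: u n + t n *: v n|) ->
  `|u n - v n| @[n --> \oo] --> 0.
Proof.
move=> UC eps0 r0 tP uP vP uvP; apply/cvgrPdist_lt => e e0.
have [d d0 dP] := uniformly_convex_near_extremal UC eps0 e0 r0.
near=> n; rewrite sub0r normrN normr_id; apply: (dP (t n)) => //.
- by near: n; exact: uP.
- by near: n; exact: vP.
- by near: n; exact: uvP.
Unshelve. all: by end_near. Qed.

(** Distinct weak subsequential limits [q], [q'] in [F] would give, by Opial's condition along each
    subsequence, both strict inequalities between the limits of [|x n - q|] and [|x n - q'|]. *)
Lemma opial_weakly_cvg (R : realType) (E : completeNormedModType R)
    (F K : set E) (x : nat -> E) (B : R) :
  uniformly_convex E -> smooth E -> opial E ->
  closed K -> midpoint_convex K -> (forall n, K (x n)) ->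
  (forall n, `|x n| <= B) ->
  (forall w, F w -> cvgn (fun n => `|x n - w|)) ->
  (forall s q, (forall k, (k <= s k)%N) -> K q -> weakly_cvg (x \o s) q -> F q) ->
  exists2 q, F q & weakly_cvg x q.
Proof.
move=> UC sm op cK mK Kx xB xF subF.
have [s [q [sk xsq qC]]] := bounded_weakly_cvg_subsequence UC sm xB.
have Fq : F q by apply: subF xsq => //; exact: qC.
have lim_le s' q' w : (forall k, (k <= s' k)%N) -> weakly_cvg (x \o s') q' ->
    F q' -> F w -> w <> q' ->
    limn (fun n => `|x n - q'|) < limn (fun n => `|x n - w|).
  move=> s'k xq' Fq' Fw wq'.
  have cs u : F u -> `|(x \o s') n - u| @[n --> \oo] --> limn (fun n => `|x n - u|).
    by move=> Fu; apply: (cvg_comp s' (fun n => `|x n - u|) (cvgn_ge_id s'k)); exact: xF.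
  have [a [b [ab aP bP]]] := opial_gap op xq' wq'.
  have : limn (fun n => `|x n - q'|) <= a.
    rewrite -(cvg_lim _ (cs _ Fq'))//; apply: limr_le => //.
    by apply/cvg_ex; eexists; exact: cs.
  have : b <= limn (fun n => `|x n - w|).
    rewrite leNgt; apply/negP => lb.
    have [N _ NP] := cvgr_lt _ (cs _ Fw) _ lb.
    by have [n Nn] := bP N; have /= := NP n Nn; rewrite ltNge => /negP.
  by lra.
exists q => // f fc; apply/cvgrPdist_lt => e e0; apply: contrapT => nfe.
(* This subsequence keeps [f (x n)] at distance [e] from [f q], so a weak limit [q'] extracted from
   it cannot be [q]. *)
have /choice[s' s'P] : forall k, exists n, (k <= n)%N /\ e <= `|f q - f (x n)|.
  move=> k; apply: contrapT => nk; apply: nfe; exists k => // n /= kn.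
  by rewrite ltNge; apply/negP => en; apply: nk; exists n.
have xs'B n : `|(x \o s') n| <= B by exact: xB.
have [s2 [q' [s2k xq' q'C]]] := bounded_weakly_cvg_subsequence UC sm xs'B.
have s'k k : (k <= s' (s2 k))%N by apply: leq_trans (s2k k) _; exact: (s'P _).1.
have Fq' : F q' by apply: (subF (s' \o s2)) => //; apply: q'C => // n; exact: Kx.
have [qq'|qq'] := pselect (q' = q).
  have := xq' f fc; rewrite qq' => /cvgrPdist_lt /(_ e e0) [N _ /(_ N (leqnn N))].
  by rewrite /= ltNge => /negP; apply; exact: (s'P _).2.
have := lim_le _ _ _ sk xsq Fq Fq' qq'.
have := lim_le (s' \o s2) _ _ s'k xq' Fq' Fq (nesym qq').
by lra.
Qed.

Lemma cvg0_le (R : realType) (f g : nat -> R) :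
  (forall n, 0 <= f n) -> (forall n, f n <= g n) ->
  g @ \oo --> 0 -> f @ \oo --> 0.
Proof.
move=> f0 fg g0; apply: (squeeze_cvgr _ (@cvg_cst _ (0 : R) _ \oo _) g0).
by apply: nearW => n; rewrite f0 fg.
Qed.

(** Of the iterates only a perturbed bound towards [w] and a common Lipschitz constant are kept. The
    bounds [g] and [h] have the same limit [r] as [a], so Schu's lemma applies first to the outer
    and then to the inner combination. *)
Lemma two_step_iteration (R : realType) (E : normedModType R) (K : set E)
    (A1 A2 : nat -> E -> E) (eps L Bb Bc : R) (s t b c : nat -> R)
    (x y : nat -> E) (w : E) :
  uniformly_convex E -> 0 < eps -> 0 <= L ->
  (forall n, eps <= t n <= 1 - eps) -> (forall n, eps <= s n <= 1 - eps) ->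
  (forall n, 0 <= b n) -> (forall n, 0 <= c n) ->
  (forall N, \sum_(i < N) b i <= Bb) -> (forall N, \sum_(i < N) c i <= Bc) ->
  b @ \oo --> 0 -> c @ \oo --> 0 ->
  (forall n, K (x n)) -> (forall n, K (y n)) ->
  (forall n u, K u -> `|A1 n u - w| <= (1 + b n) * `|u - w| + c n) ->
  (forall n u, K u -> `|A2 n u - w| <= (1 + b n) * `|u - w| + c n) ->
  (forall n u v, K u -> K v -> `|A1 n u - A1 n v| <= L * `|u - v|) ->
  (forall n u v, K u -> K v -> `|A2 n u - A2 n v| <= L * `|u - v|) ->
  (forall n, y n = (1 - s n) *: x n + s n *: A1 n (x n)) ->
  (forall n, x n.+1 = (1 - t n) *: A1 n (y n) + t n *: A2 n (y n)) ->
  [/\ cvgn (fun n => `|x n - w|),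
      `|x n - A1 n (x n)| @[n --> \oo] --> 0,
      `|x n - A2 n (x n)| @[n --> \oo] --> 0 &
      `|x n - x n.+1| @[n --> \oo] --> 0].
Proof.
move=> UC eps0 L0 tP sP b0 c0 bB cB cvgb cvgc Kx Ky A1w A2w A1L A2L yE xE.
pose a n := `|x n - w|.
have a0 n : 0 <= a n by exact: normr_ge0.
have conv_sub (k : R) (u v : E) :
    (1 - k) *: u + k *: v - w = (1 - k) *: (u - w) + k *: (v - w).
  rewrite !scalerBr addrACA -opprD -scalerDl.
  by have -> : 1 - k + k = 1; [lra|rewrite scale1r].
have conv_le (k : R) (u v : E) (q : R) : eps <= k <= 1 - eps ->
    `|u| <= q -> `|v| <= q -> `|(1 - k) *: u + k *: v| <= q.
  move=> /andP[k1 k2] uq vq; rewrite (le_trans (ler_normD _ _))// !normrZ.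
  rewrite (ger0_norm (_ : 0 <= 1 - k)); last by lra.
  rewrite (ger0_norm (_ : 0 <= k)); last by lra.
  have : (1 - k) * `|u| <= (1 - k) * q by rewrite ler_wpM2l//; lra.
  have : k * `|v| <= k * q by rewrite ler_wpM2l//; lra.
  by lra.
pose g n := (1 + b n) * a n + c n.
pose h n := (1 + b n) * g n + c n.
have b1 n : 0 <= 1 + b n by rewrite addr_ge0.
have ag n : a n <= g n.
  have : 0 <= b n * a n by exact: mulr_ge0 (b0 n) (a0 n).
  by have := c0 n; rewrite /g; lra.
have yg n : `|y n - w| <= g n.
  by rewrite yE conv_sub; apply: conv_le => //; [exact: ag|exact: A1w].
have A1h n : `|A1 n (y n) - w| <= h n.
  by rewrite (le_trans (A1w n _ (Ky n)))// /h lerD2r ler_wpM2l.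
have A2h n : `|A2 n (y n) - w| <= h n.
  by rewrite (le_trans (A2w n _ (Ky n)))// /h lerD2r ler_wpM2l.
have bBb n : b n <= Bb.
  by rewrite (le_trans _ (bB n.+1))// big_ord_recr/= lerDr sumr_ge0.
(* Expanding [h n] produces [b n ^ 2] and [b n * c n]; bounding one factor [b n] by [Bb] gives the
   coefficient [2 + Bb]. *)
have Bb0 : 0 <= 2 + Bb by have := bBb 0%N; have := b0 0%N; lra.
have arec n : a n.+1 <= (1 + (2 + Bb) * b n) * a n + (2 + Bb) * c n.
  have -> : a n.+1 = `|x n.+1 - w| by [].
  rewrite xE conv_sub (le_trans (conv_le _ _ _ (h n) _ _ _))//.
  have : b n * (b n * a n) <= Bb * (b n * a n).
    by rewrite ler_wpM2r// mulr_ge0.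
  have : b n * c n <= Bb * c n by rewrite ler_wpM2r.
  by rewrite /h /g; lra.
have cva : cvgn a.
  apply: (@perturbed_nonincreasing_is_cvgn _ a (fun n => (2 + Bb) * b n)
    (fun n => (2 + Bb) * c n) ((2 + Bb) * Bb) ((2 + Bb) * Bc)) => // n.
  - exact: mulr_ge0.
  - exact: mulr_ge0.
  - by rewrite -mulr_sumr ler_wpM2l.
  - by rewrite -mulr_sumr ler_wpM2l.
pose r := limn a; have ar : a @ \oo --> r by [].
have r0 : 0 <= r by apply: limr_ge => //; apply: nearW => n; exact: normr_ge0.
have cvgb1 : (fun n => 1 + b n) @ \oo --> (1 : R).
  by rewrite -[X in _ --> X]addr0; apply: cvgD => //; exact: cvg_cst.
have step (f : nat -> R) : f @ \oo --> r ->
    (fun n => (1 + b n) * f n + c n) @ \oo --> r.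
  move=> fr; rewrite -[X in _ --> X](addr0 r); apply: cvgD => //.
  by rewrite -(mul1r r); exact: cvgM.
have gr : g @ \oo --> r by exact: step.
have hr : h @ \oo --> r by exact: step.
have le_near (f : nat -> R) (u : nat -> E) : f @ \oo --> r ->
    (forall n, `|u n| <= f n) ->
    forall e, 0 < e -> \forall n \near \oo, `|u n| <= r + e.
  move=> fr uf e e0; have re : r < r + e by rewrite ltrDl.
  by apply: filterS (cvgr_lt _ fr _ re) => n /ltW; exact: le_trans.
have ge_near (f : nat -> R) (u : nat -> E) : f @ \oo --> r ->
    (forall n, f n <= `|u n|) ->
    forall e, 0 < e -> \forall n \near \oo, r - e <= `|u n|.
  move=> fr uf e e0; have re : r - e < r by rewrite ltrBlDr ltrDl.
  by apply: filterS (cvgr_gt _ fr _ re) => n /ltW fn; exact: le_trans fn _.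
have aSr : (fun n => a n.+1) @ \oo --> r by rewrite cvg_shiftS.
have A12 : `|A1 n (y n) - A2 n (y n)| @[n --> \oo] --> 0.
  have := uniformly_convex_cvg_dist0 UC eps0 r0 tP (le_near _ _ hr A1h)
    (le_near _ _ hr A2h).
  under eq_fun do rewrite opprB addrA subrK.
  apply; apply: (ge_near _ _ aSr) => n; rewrite -conv_sub -xE; exact: lexx.
have xA1 : `|x n - A1 n (x n)| @[n --> \oo] --> 0.
  have := uniformly_convex_cvg_dist0 UC eps0 r0 sP (le_near _ _ ar (fun=> lexx _))
    (le_near _ _ gr (fun n => A1w n _ (Kx n))).
  under eq_fun do rewrite opprB addrA subrK.
  (* [x n.+1] differs from [A1 n (y n)] by at most [|A1 n (y n) - A2 n (y n)|], which tends to 0; so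
     [low n] bounds [|y n - w|] below and tends to [r]. *)
  apply; pose low n := a n.+1 - c n - `|A1 n (y n) - A2 n (y n)| - b n * g n.
  apply: (ge_near low) => [|n].
    have -> : r = r - 0 - 0 - 0 * r by rewrite mul0r !subr0.
    by apply: cvgB; [apply: cvgB => //; exact: cvgB|exact: cvgM].
  rewrite -conv_sub -yE /low.
  have tn : `|t n| <= 1.
    by have /andP[t1 t2] := tP n; rewrite ger0_norm; lra.
  have : a n.+1 <= `|A1 n (y n) - w| + `|A1 n (y n) - A2 n (y n)|.
    have -> : a n.+1 = `|A1 n (y n) - w - t n *: (A1 n (y n) - A2 n (y n))|.
      rewrite /a xE scalerBl scale1r scalerBr; congr (`|_|).
      by rewrite [RHS]addrAC opprB addrA [A1 n (y n) + _ - _]addrAC.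
    rewrite (le_trans (ler_normB _ _))// lerD2l normrZ.
    by rewrite ler_piMl.
  have := A1w n _ (Ky n); have : b n * `|y n - w| <= b n * g n by rewrite ler_wpM2l.
  by lra.
have xy n : `|x n - y n| <= `|x n - A1 n (x n)|.
  have -> : x n - y n = s n *: (x n - A1 n (x n)).
    by rewrite yE scalerBl scale1r scalerBr opprD opprB addrA subrKC.
  have /andP[s1 s2] := sP n; rewrite normrZ ger0_norm; last by lra.
  by rewrite ler_piMl//; lra.
have AL n (F : E -> E) : (forall u v, K u -> K v -> `|F u - F v| <= L * `|u - v|) ->
    `|F (x n) - F (y n)| <= L * `|x n - A1 n (x n)|.
  by move=> FL; rewrite (le_trans (FL _ _ (Kx n) (Ky n)))// ler_wpM2l.
(* The path runs through [A1 n (x n)], [A1 n (y n)] and [A2 n (y n)]; its Lipschitz legs are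
   controlled by [|x n - y n| <= |x n - A1 n (x n)|]. *)
have xA2 : `|x n - A2 n (x n)| @[n --> \oo] --> 0.
  apply: (@cvg0_le _ _ (fun n => (1 + 2 * L) * `|x n - A1 n (x n)| +
    `|A1 n (y n) - A2 n (y n)|)) => // [n|].
    have := AL n _ (A1L n); have := AL n _ (A2L n).
    have := ler_distD (A1 n (x n)) (x n) (A2 n (x n)).
    have := ler_distD (A1 n (y n)) (A1 n (x n)) (A2 n (x n)).
    have := ler_distD (A2 n (y n)) (A1 n (y n)) (A2 n (x n)).
    by rewrite [`|A2 n (y n) - A2 n (x n)|]distrC; lra.
  rewrite (_ : 0 = (1 + 2 * L) * 0 + 0); last by rewrite mulr0 addr0.
  by apply: cvgD => //; exact: cvgZr.
split=> //.
apply: (@cvg0_le _ _ (fun n => (1 + L) * `|x n - A1 n (x n)| +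
  `|A1 n (y n) - A2 n (y n)|)) => // [n|].
  have := AL n _ (A1L n).
  have := ler_distD (A1 n (x n)) (x n) (x n.+1).
  have := ler_distD (A1 n (y n)) (A1 n (x n)) (x n.+1).
  suff : `|A1 n (y n) - x n.+1| <= `|A1 n (y n) - A2 n (y n)| by lra.
  have -> : A1 n (y n) - x n.+1 = t n *: (A1 n (y n) - A2 n (y n)).
    by rewrite xE scalerBl scale1r scalerBr opprD opprB addrA subrKC.
  have /andP[t1 t2] := tP n; rewrite normrZ ger0_norm; last by lra.
  by rewrite ler_piMl//; lra.
rewrite (_ : 0 = (1 + L) * 0 + 0); last by rewrite mulr0 addr0.
by apply: cvgD => //; exact: cvgZr.
Qed.

(** Inserting [S^(n+2) x_(n+1)], one Lipschitz step reduces its distance to [S x_(n+1)] to that of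
    [S^(n+1) x_(n+1)] and [x_(n+1)]; moving the base point to [x_n] costs
    [(1 + L) |x_n - x_(n+1)|]. *)
Lemma asymptotically_regular (R : realType) (E : normedModType R) (K : set E)
    (S : E -> E) (L : R) (x : nat -> E) :
  0 <= L -> (forall u, K u -> K (S u)) -> (forall n, K (x n)) ->
  (forall n u v, K u -> K v ->
     `|iter n.+1 S u - iter n.+1 S v| <= L * `|u - v|) ->
  `|x n - iter n.+1 S (x n)| @[n --> \oo] --> 0 ->
  `|x n - x n.+1| @[n --> \oo] --> 0 ->
  x n - S (x n) @[n --> \oo] --> 0.
Proof.
move=> L0 SK Kx SL xS xx; apply/norm_cvg0P; rewrite -cvg_shiftS.
pose d n := `|x n - iter n.+1 S (x n)|; pose e n := `|x n - x n.+1|.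
apply: (@cvg0_le _ _ (fun n => d n.+1 + L * (d n + (1 + L) * e n))) => [n|n|].
- exact: normr_ge0.
- rewrite /= (le_trans (ler_distD (iter n.+2 S (x n.+1)) _ _))// lerD2l.
  have Ki : K (iter n.+1 S (x n.+1)).
    by have := Kx n.+1; elim: (n.+1) (x n.+1) => //= k IH u Ku; apply/SK/IH.
  rewrite (le_trans (SL 0%N _ _ Ki (Kx n.+1)))// ler_wpM2l//.
  rewrite (le_trans (ler_distD (iter n.+1 S (x n)) _ _))//.
  have := SL n _ _ (Kx n.+1) (Kx n).
  have := ler_distD (x n) (iter n.+1 S (x n)) (x n.+1).
  by rewrite [`|x n.+1 - x n|]distrC [`|iter n.+1 S (x n) - x n|]distrC /d /e; lra.
- have -> : 0 = 0 + L * (0 + (1 + L) * 0) by rewrite !(mulr0, addr0).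
  apply: cvgD; first by rewrite cvg_shiftS.
  by apply: cvgZr; apply: cvgD => //; exact: cvgZr.
Qed.

Lemma convex_set_comb (R : realType) (E : normedModType R) (K : set E)
    (t : R) (u v : E) :
  convex_set (K : set (convex_lmodType E)) -> 0 <= t -> t <= 1 ->
  K u -> K v -> K ((1 - t) *: u + t *: v).
Proof.
move=> cK t0 t1 Ku Kv.
have := cK v u (Itv01 t0 t1) (mem_set Kv) (mem_set Ku).
by move=> /set_mem; rewrite addrC.
Qed.

(** * Estimates for the iterates of [P \o T] *)

Section retracted_mapping.
Context {R : realType} {E : normedModType R} (K : set E) (P T : E -> E) (L : R)
  (mu lambda : nat -> R) (phi : R -> R) (M Mstar : R).
Hypothesis PK : sunny_nonexpansive_retraction K P.
Hypothesis TL : uniformly_lipschitzian K P L T.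
Hypothesis TA : total_asymptotically_nonexpansive K P mu lambda phi T.
Hypothesis phiM : forall kappa, M <= kappa -> phi kappa <= Mstar * kappa.
Hypothesis M0 : 0 < M.
Hypothesis Mstar0 : 0 < Mstar.

Lemma retracted_iter_in n u : K u -> K (iter n (P \o T) u).
Proof. by have [PinK _ _ _] := PK; case: n => [|n] Ku //=; exact: PinK. Qed.

Lemma retracted_iter_lipschitz n u v : K u -> K v ->
  `|iter n.+1 (P \o T) u - iter n.+1 (P \o T) v| <= L * `|u - v|.
Proof.
move=> Ku Kv; have [_ _ Pne _] := PK; have [_ TLn] := TL.
by rewrite (le_trans (Pne _ _))//; exact: (TLn u v n.+1).
Qed.

(** Below [M] monotonicity gives [phi M], above it the linear bound applies. The [phi] term thus
    splits into a multiplicative and an additive perturbation, both proportional to [mu n]. *)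
Lemma affine_bound_of_eventually_linear kappa :
  0 <= kappa -> phi kappa <= phi M + Mstar * kappa.
Proof.
move=> k0; have [_ _ [phiI _ phi0] _] := TA.
have phiM0 : 0 < phi M by rewrite -phi0 phiI.
have [Mk|kM] := leP M kappa; first by have := phiM Mk; lra.
have := phiI _ _ kM; have : 0 <= Mstar * kappa by exact: mulr_ge0 (ltW Mstar0) k0.
by lra.
Qed.

Lemma dist_retracted_iter_fixed n u w : K u -> fixed_points K T w ->
  `|iter n.+1 (P \o T) u - w| <=
    (1 + mu n.+1 * Mstar) * `|u - w| + (mu n.+1 * phi M + lambda n.+1).
Proof.
move=> Ku [Kw Tw]; have [_ Pid _ _] := PK; have [ml0 _ _ TAn] := TA.
have Sw m : iter m (P \o T) w = w by elim: m => //= m ->; rewrite Tw Pid.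
have := TAn u w n.+1 Ku Kw isT; rewrite Sw => /le_trans; apply.
have [mu0 _] := ml0 n.+1 isT.
have := ler_wpM2l mu0 (affine_bound_of_eventually_linear (normr_ge0 (u - w))).
by lra.
Qed.

(** All distances [|z n - z0|] are at most [B], so the error [mu m * phi B + lambda m] is uniform in
    [n], as the Opial argument for [P \o T] requires. Sunniness then passes from [P \o T] to [T]. *)
Lemma retracted_weak_limit_fixed_point (z : nat -> E) (z0 : E) (B : R) :
  uniformly_convex E -> opial E -> weakly_inward K T -> weakly_cvg z z0 ->
  (forall n, K (z n)) -> K z0 -> (forall n, `|z n - z0| <= B) ->
  z n - P (T (z n)) @[n --> \oo] --> (0 : E) ->
  fixed_points K T z0.
Proof.
move=> UC op TK zz0 Kz Kz0 zB zPT; split=> //.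
have [L0 _] := TL; have [ml0 [mucvg lacvg] [phiI _ _] TAn] := TA.
apply: (sunny_weakly_inward_fixed_point PK TK Kz0).
apply: (@opial_weak_limit_fixed_point _ _ K (P \o T) L B z) => //.
- exact: ltW.
- by move=> u Ku; exact: (retracted_iter_in 1).
- by move=> u v Ku Kv; exact: (retracted_iter_lipschitz 0).
move=> e e0.
have cvg0 : mu m * phi B + lambda m @[m --> \oo] --> 0.
  rewrite (_ : 0 = 0 * phi B + 0); last by rewrite mul0r addr0.
  by apply: cvgD => //; exact: cvgMl.
apply: filterS2 (nbhs_infty_ge 1) (cvgr_lt _ cvg0 _ e0) => m m1 me n.
rewrite (le_trans (TAn _ _ m (Kz n) Kz0 m1))// -addrA lerD2l.
rewrite (le_trans _ (ltW me))// lerD2r ler_wpM2l//; first by have [] := ml0 m m1.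
have [zBn|zBn] := eqVneq `|z n - z0| B; first by rewrite zBn.
by apply/ltW/phiI; rewrite lt_neqAle zBn zB.
Qed.

End retracted_mapping.

(** * Weak convergence of the scheme *)

Theorem theorem4 (R : realType) (E : completeNormedModType R)
    (K : set E) (P T1 T2 : E -> E) (L : R)
    (mu lambda : nat -> R) (phi : R -> R) (M Mstar eps : R)
    (alpha beta : nat -> R) (x y : nat -> E) :
  uniformly_convex E -> smooth E -> opial E ->
  K !=set0 -> closed K -> convex_set (K : set (convex_lmodType E)) ->
  sunny_nonexpansive_retraction K P ->
  weakly_inward K T1 -> weakly_inward K T2 ->
  uniformly_lipschitzian K P L T1 -> uniformly_lipschitzian K P L T2 ->
  total_asymptotically_nonexpansive K P mu lambda phi T1 ->
  total_asymptotically_nonexpansive K P mu lambda phi T2 ->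
  (\sum_(1 <= n <oo) (mu n)%:E < +oo)%E ->
  (\sum_(1 <= n <oo) (lambda n)%:E < +oo)%E ->
  fixed_points K T1 `&` fixed_points K T2 !=set0 ->
  0 < M -> 0 < Mstar -> (forall kappa, M <= kappa -> phi kappa <= Mstar * kappa) ->
  0 < eps -> eps < 1 ->
  (forall n, (1 <= n)%N -> eps <= alpha n <= 1 - eps) ->
  (forall n, (1 <= n)%N -> eps <= beta n <= 1 - eps) ->
  K (x 1%N) ->
  (forall n, (1 <= n)%N ->
     y n = (1 - beta n) *: x n + beta n *: iter n (P \o T1) (x n)) ->
  (forall n, (1 <= n)%N ->
     x n.+1 = (1 - alpha n) *: iter n (P \o T1) (y n)
              + alpha n *: iter n (P \o T2) (y n)) ->
  demiclosed K (fun z => z - T1 z) 0 -> demiclosed K (fun z => z - T2 z) 0 ->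
  exists2 q : E, (fixed_points K T1 `&` fixed_points K T2) q & weakly_cvg x q.
Proof.
move=> UC sm op _ clK cvK PK T1K T2K T1L T2L T1A T2A muoo laoo [p Fp] M0 Ms0 phiM.
move=> eps0 _ alphaP betaP Kx1 yE xE _ _.
have [[L0 _] [ml0 [mu0 la0] [phiI _ phi0] _]] := (T1L, T1A).
have phiM0 : 0 < phi M by rewrite -phi0 phiI.
have in01 (t : R) : eps <= t <= 1 - eps -> 0 <= t /\ t <= 1.
  by move=> /andP[t1 t2]; lra.
have Kxy n : K (x n.+1) /\ K (y n.+1).
  have Ky m : K (x m.+1) -> K (y m.+1).
    move=> Kxm; have [b0 b1] := in01 _ (betaP m.+1 isT).
    by rewrite yE//; apply: convex_set_comb => //; exact: retracted_iter_in.
  elim: n => [|n [Kxn Kyn]]; first by split=> //; exact: Ky.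
  suff Kx : K (x n.+2) by split=> //; exact: Ky.
  have [a0 a1] := in01 _ (alphaP n.+1 isT).
  by rewrite xE//; apply: convex_set_comb => //; exact: retracted_iter_in.
have [Bmu muB] := summable_partial_sums_bounded (fun n n1 => (ml0 n n1).1) muoo.
have [Bla laB] := summable_partial_sums_bounded (fun n n1 => (ml0 n n1).2) laoo.
(* Everything is shifted by one, since the scheme starts at index 1. The perturbations
   [mu n * Mstar] and [mu n * phi M + lambda n] are summable. *)
have iterate w : (fixed_points K T1 `&` fixed_points K T2) w ->
  [/\ cvgn (fun n => `|x n.+1 - w|),
      `|x n.+1 - iter n.+1 (P \o T1) (x n.+1)| @[n --> \oo] --> 0,
      `|x n.+1 - iter n.+1 (P \o T2) (x n.+1)| @[n --> \oo] --> 0 &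
      `|x n.+1 - x n.+2| @[n --> \oo] --> 0].
  move=> [F1 F2]; apply: (@two_step_iteration _ _ K
    (fun n => iter n.+1 (P \o T1)) (fun n => iter n.+1 (P \o T2)) eps L
    (Bmu * Mstar) (Bmu * phi M + Bla)
    (fun n => beta n.+1) (fun n => alpha n.+1)
    (fun n => mu n.+1 * Mstar) (fun n => mu n.+1 * phi M + lambda n.+1)
    (fun n => x n.+1) (fun n => y n.+1) w UC eps0 (ltW L0)
    (fun n => alphaP n.+1 isT) (fun n => betaP n.+1 isT)).
  - by move=> n; rewrite mulr_ge0 ?(ltW Ms0)//; have [] := ml0 n.+1 isT.
  - move=> n; have [m0 l0] := ml0 n.+1 isT.
    by rewrite addr_ge0 ?mulr_ge0 ?(ltW phiM0).
  - by move=> N; rewrite -mulr_suml; exact: ler_wpM2r (ltW Ms0) _ _ (muB N).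
  - move=> N; rewrite big_split/= -mulr_suml; apply: lerD (laB N).
    exact: ler_wpM2r (ltW phiM0) _ _ (muB N).
  - rewrite -(mul0r Mstar); apply: cvgMl; by rewrite cvg_shiftS.
  - rewrite (_ : 0 = 0 * phi M + 0); last by rewrite mul0r addr0.
    by apply: cvgD; [apply: cvgMl; rewrite cvg_shiftS|rewrite cvg_shiftS].
  - by move=> n; have [] := Kxy n.
  - by move=> n; have [] := Kxy n.
  - by move=> n u Ku; exact: (dist_retracted_iter_fixed PK T1A).
  - by move=> n u Ku; exact: (dist_retracted_iter_fixed PK T2A).
  - by move=> n u v; exact: (retracted_iter_lipschitz PK T1L).
  - by move=> n u v; exact: (retracted_iter_lipschitz PK T2L).
  - by move=> n; exact: yE.
  - by move=> n; exact: xE.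
have [xp xT1 xT2 xx] := iterate p Fp.
have reg T : uniformly_lipschitzian K P L T ->
    `|x n.+1 - iter n.+1 (P \o T) (x n.+1)| @[n --> \oo] --> 0 ->
    x n.+1 - P (T (x n.+1)) @[n --> \oo] --> (0 : E).
  move=> TL xT; apply: (@asymptotically_regular _ _ K (P \o T) L (fun n => x n.+1)) => //.
  - exact: ltW.
  - by move=> u Ku; exact: (@retracted_iter_in _ _ K P T PK 1).
  - by move=> n; have [] := Kxy n.
  - by move=> n u v; exact: (retracted_iter_lipschitz PK TL).
have [B xB] : exists B, forall n, `|x n.+1| <= B.
  have /cvg_seq_bounded/bounded_fun_has_ubound[B BP] := xp.
  exists (B + `|p|) => n; rewrite -lerBlDr (le_trans (lerB_dist _ _))//.
  by apply: BP; exists n.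
have [q Fq xq] : exists2 q, (fixed_points K T1 `&` fixed_points K T2) q &
    weakly_cvg (fun n => x n.+1) q.
  apply: (@opial_weakly_cvg _ _ _ K (fun n => x n.+1) B) => //.
  - move=> u v Ku Kv; rewrite midpoint_half; apply: convex_set_comb => //; lra.
  - by move=> n; have [] := Kxy n.
  - by move=> w Fw; have [] := iterate w Fw.
  move=> s q sk Kq xsq.
  have fixq T : weakly_inward K T -> uniformly_lipschitzian K P L T ->
      total_asymptotically_nonexpansive K P mu lambda phi T ->
      `|x n.+1 - iter n.+1 (P \o T) (x n.+1)| @[n --> \oo] --> 0 ->
      fixed_points K T q.
    move=> TK TL TA xT.
    apply: (retracted_weak_limit_fixed_point (B := B + `|q|) PK TL TA UC op TK xsq) => //.
    - by move=> n; have [] := Kxy (s n).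
    - by move=> n; rewrite (le_trans (ler_normB _ _))// lerD2r; exact: xB.
    - exact: (cvg_comp s (fun n => x n.+1 - P (T (x n.+1))) (cvgn_ge_id sk)
        (reg T TL xT)).
  by split; [exact: fixq|exact: fixq].
exists q => // f fc; have := xq f fc.
by rewrite -(cvg_shiftS (fun n => f (x n))).
Qed.
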